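(* Let $S,T\subseteq\mathbb{F}_2^n$ be sets with $|S|=|T|=k$ and $\dim S=\dim T=k-3$. Then $S$ and $T$ are affinely equivalent if and only if $S$ and $T$ have the same multisets of Venn region cardinalities (with respect to $E(S)$ and $E(T)$ respectively) and the same number of isolated points.
   Context: The dimension of $S\subseteq\mathbb{F}_2^n$ is the dimension of its affine span. $S,T$ are affinely equivalent if some affine automorphism $f$ of $\mathbb{F}_2^n$ has $f(S)=T$. $\mathcal{P}(S)$ is an $\mathbb{F}_2$-vector space under symmetric difference $\triangle$. $E(S)$ is the subspace of even zero-sum subsets of $S$: subsets of even size whose elements sum to $\vec 0$ (including $\varnothing$). For a basis $\mathscr{X}=(X_1,\dots,X_r)$ of $E(S)$ and $\vec a\in\mathbb{F}_2^r$ with support $I_{\vec a}$, the Venn region $v_{\mathscr{X}}(\vec a)=\bigcap_{i\in I_{\vec a}}X_i\cap\bigcap_{i\notin I_{\vec a}}(S\setminus X_i)$; the multiset of Venn region cardinalities is $\{|v_{\mathscr{X}}(\vec a)|:\vec a\in\mathbb{F}_2^r\}$ (with multiplicity, independent of the basis). The isolated points are the elements of $v_{\mathscr{X}}(\vec 0)$, i.e. the points of $S$ lying in no element of $E(S)$. *)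

(* Defs.v *)
From HB Require Import structures.
From mathcomp Require Import all_boot all_order all_algebra.

Set Implicit Arguments.
Unset Strict Implicit.
Unset Printing Implicit Defensive.

Import GRing.Theory.
Local Open Scope ring_scope.

Section Affine.
Variable n : nat.
Local Notation V := 'rV['F_2]_n.
Implicit Types S T A : {set V}.

Definition affine_span S : {set V} :=
  [set \sum_(x in S) c x *: x | c : {ffun V -> 'F_2} & \sum_(x in S) c x == 1].

Definition direction A : {vspace V} := <<[seq x - y | x <- enum A, y <- enum A]>>%VS.

(* The empty set, usually given dimension -1, gets dimension 0 here. *)
Definition affine_dim S : nat := \dim (direction (affine_span S)).

Definition affine_automorphism (f : V -> V) : Prop :=
  exists (M : 'M['F_2]_n) (b : V), M \in unitmx /\ forall x, f x = x *m M + b.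

Definition affinely_equivalent S T : Prop :=
  exists f : V -> V, affine_automorphism f /\ f @: S = T.

End Affine.

Definition symdiff (T : finType) (X Y : {set T}) : {set T} := (X :\: Y) :|: (Y :\: X).

Lemma in_symdiff (T : finType) (X Y : {set T}) x :
  (x \in symdiff X Y) = (x \in X) (+) (x \in Y).
Proof. by rewrite !inE; case: (x \in X); case: (x \in Y). Qed.

(* P(T) as an F_2-vector space under symmetric difference: an alias of
   [{set T}], so that [{set T}] itself gets no additive structure. *)
Definition pset (T : finType) : Type := {set T}.

HB.instance Definition _ (T : finType) := Finite.copy (pset T) {set T}.

Section PSet.
Variable T : finType.
Implicit Types (a b : 'F_2) (X Y Z : pset T).

Definition pset_scale a X : pset T := if a == 0 then set0 else X.

Fact pset_addA : associative (@symdiff T : pset T -> pset T -> pset T).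
Proof. by move=> X Y Z; apply/setP=> x; rewrite !in_symdiff addbA. Qed.
Fact pset_addC : commutative (@symdiff T : pset T -> pset T -> pset T).
Proof. by move=> X Y; apply/setP=> x; rewrite !in_symdiff addbC. Qed.
Fact pset_add0 : left_id (set0 : pset T) (@symdiff T).
Proof. by move=> X; apply/setP=> x; rewrite in_symdiff in_set0. Qed.
Fact pset_addN : left_inverse (set0 : pset T) id (@symdiff T).
Proof. by move=> X; apply/setP=> x; rewrite in_symdiff in_set0 addbb. Qed.

HB.instance Definition _ :=
  GRing.isZmodule.Build (pset T) pset_addA pset_addC pset_add0 pset_addN.

Lemma in_psetD X Y (x : T) :
  (x \in (X + Y : {set T})) = (x \in (X : {set T})) (+) (x \in (Y : {set T})).
Proof. exact: in_symdiff. Qed.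

Lemma F2_cases a : a = 0 \/ a = 1.
Proof. by case: a => [[|[|//]] ?]; [left | right]; apply/val_inj. Qed.

Lemma F2_addrr a : a + a = 0.
Proof. by case: (F2_cases a) => ->; apply/val_inj. Qed.

Fact pset_scaleA a b X : pset_scale a (pset_scale b X) = pset_scale (a * b) X.
Proof.
by case: (F2_cases a) => ->; case: (F2_cases b) => ->; rewrite /pset_scale ?mul0r ?mul1r.
Qed.
Fact pset_scale1 : left_id 1 pset_scale.
Proof. by []. Qed.
Fact pset_scaleDr : right_distributive pset_scale +%R.
Proof. by move=> a X Y; case: (F2_cases a) => ->; rewrite /pset_scale //= [RHS]addr0. Qed.
Fact pset_scaleDl X : {morph pset_scale^~ X : a b / a + b}.
Proof.
move=> a b; case: (F2_cases a) => ->; case: (F2_cases b) => ->; rewrite /pset_scale /=.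
- by rewrite [RHS]addr0.
- by rewrite [RHS]add0r.
- by rewrite [RHS]addr0.
- by rewrite -[RHS]/(X - X) subrr.
Qed.

HB.instance Definition _ := GRing.Zmodule_isLmodule.Build 'F_2 (pset T)
  pset_scaleA pset_scale1 pset_scaleDr pset_scaleDl.

Lemma sum_psetD (W : zmodType) (f : T -> W) X Y : (forall w : W, w + w = 0) ->
  \sum_(x in (X + Y : {set T})) f x =
  \sum_(x in (X : {set T})) f x + \sum_(x in (Y : {set T})) f x.
Proof.
move=> W2; rewrite !(big_mkcond (fun x => x \in _)) -big_split /=.
apply: eq_bigr => x _; rewrite in_psetD.
by case: (x \in _); case: (x \in _); rewrite /= ?addr0 ?add0r ?W2.
Qed.

Definition pset_row X : 'rV['F_2]_#|T| :=
  \row_i ((enum_val i \in (X : {set T}))%:R).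

Fact pset_vect : Vector.axiom #|T| (pset T).
Proof.
exists pset_row.
  move=> a X Y; apply/rowP=> i; rewrite !mxE in_psetD.
  case: (F2_cases a) => ->.
    by rewrite scale0r in_set0 mul0r add0r.
  rewrite scale1r mul1r.
  by case: (_ \in _); case: (_ \in _); apply/val_inj.
exists (fun v : 'rV['F_2]_#|T| => [set x | v 0 (enum_rank x) != 0]).
  move=> X; apply/setP=> x; rewrite inE mxE enum_rankK.
  by case: (_ \in _).
move=> v; apply/rowP=> i; rewrite mxE inE enum_valK.
by case: (F2_cases (v 0 i)) => ->.
Qed.

HB.instance Definition _ := Lmodule_hasFinDim.Build 'F_2 (pset T) pset_vect.

End PSet.

Section EvenZeroSum.
Variable n : nat.
Local Notation V := 'rV['F_2]_n.
Implicit Types S X : {set V}.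

Definition even_zero_sum S : {set pset V} :=
  [set X : {set V} | [&& X \subset S, ~~ odd #|X| & \sum_(x in X) x == 0]].

Definition E S : {vspace pset V} := <<enum (even_zero_sum S)>>%VS.

(* Spanning adds no new elements: the even zero-sum subsets form a subspace. *)
Lemma memE S X :
  ((X : pset V) \in E S) = [&& X \subset S, ~~ odd #|X| & \sum_(x in X) x == 0].
Proof.
apply/idP/idP => [XE | XS]; last by apply: memv_span; rewrite mem_enum inE.
suff : (X : pset V) \in even_zero_sum S by rewrite inE.
pose e := in_tuple (enum (even_zero_sum S)).
have -> : X = \sum_i coord e i (X : pset V) *: e`_i :> pset V by exact: coord_span.
have oddE (Z : {set V}) : ~~ odd #|Z| = (\sum_(x in Z) (1 : 'F_2) == 0).
  rewrite sumr_const -[in RHS](odd_double_half #|Z|) mulrnDr -muln2 mulrnA.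
  by rewrite mulr2n F2_addrr addr0; case: odd.
have E0 : (0 : pset V) \in even_zero_sum S.
  by rewrite inE sub0set cards0 big_set0 eqxx.
apply: (big_ind (fun Z : pset V => Z \in even_zero_sum S)) => // [A B | i _].
  rewrite !inE !oddE => /and3P[sA /eqP oA /eqP zA] /and3P[sB /eqP oB /eqP zB].
  rewrite sum_psetD ?oA ?oB ?addr0 ?eqxx; last exact: F2_addrr.
  rewrite sum_psetD ?zA ?zB ?addr0 ?eqxx ?andbT; last first.
    by move=> w; apply/rowP=> j; rewrite !mxE F2_addrr.
  apply/subsetP=> x; rewrite in_psetD.
  by case: (boolP (x \in A)) => [/(subsetP sA) //|_ /(subsetP sB)].
case: (F2_cases (coord e i (X : pset V))) => ->; rewrite ?scale0r // scale1r.
by rewrite -mem_enum mem_nth //.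
Qed.

Definition venn_region S r (B : r.-tuple (pset V)) (a : 'rV['F_2]_r) : {set V} :=
  S :&: \bigcap_(i < r | a 0 i != 0) (tnth B i : {set V})
    :&: \bigcap_(i < r | a 0 i == 0) (S :\: tnth B i).

(* Up to [perm_eq], this sequence is a multiset. *)
Definition venn_cards S r (B : r.-tuple (pset V)) : seq nat :=
  [seq #|venn_region S B a| | a : 'rV['F_2]_r].

Definition isolated_points S : {set V} :=
  [set x in S | [forall X : pset V, (X \in E S) ==> (x \notin (X : {set V}))]].

Lemma isolated_pointsE S r (B : r.-tuple (pset V)) :
  basis_of (E S) B -> isolated_points S = venn_region S B 0.
Proof.
move=> /andP[/eqP spanB _]; apply/setP=> x; rewrite !inE.
have -> : \bigcap_(i < r | (0 : 'rV['F_2]_r) 0 i != 0) (tnth B i : {set V}) = setT.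
  by apply: big1 => i; rewrite mxE eqxx.
rewrite inE andbT; case xS: (x \in S) => //=.
apply/forallP/bigcapP => [xE i _ | xB X].
  rewrite inE xS andbT; have /implyP := xE (tnth B i); apply.
  by rewrite -spanB memv_span ?mem_tnth.
apply/implyP; rewrite -spanB => /coord_span ->.
apply: (big_ind (fun Z : pset V => x \notin (Z : {set V}))) => [|A C|i _].
- by rewrite in_set0.
- by rewrite in_psetD => /negbTE-> /negbTE->.
case: (F2_cases (coord B i X)) => ->; first by rewrite scale0r in_set0.
rewrite scale1r -tnth_nth; have := xB i; rewrite mxE eqxx => /(_ isT).
by rewrite inE => /andP[].
Qed.

End EvenZeroSum.

(* Main.v *)
Require Import Defs.
From HB Require Import structures.
From mathcomp Require Import all_boot all_order all_algebra finfield.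

Set Implicit Arguments.
Unset Strict Implicit.
Unset Printing Implicit Defensive.

Import GRing.Theory.
Local Open Scope ring_scope.

(**
  Rank-nullity gives [dim E(S) = |S| - dim S - 1 = 2]. Label each point of S by
  its signature, the row of its memberships in the basis of E(S): the Venn
  regions are the fibres of the signature, and the members of E(S) are the
  subsets cut out by linear functionals of it. An affine bijection from S to T
  transports E(T) to E(S), hence changes signatures by an invertible matrix.
  Conversely, equal cardinalities give a permutation of the labels F_2^2 that
  fixes 0 (the isolated points) and preserves the sizes of the regions. Every
  permutation of F_2^2 fixing 0 is linear, so a bijection S -> T realizing it on
  signatures matches E(S) with E(T), that is, preserves all affine
  dependencies, and therefore extends to an affine automorphism.
*)

(** * Parity and characteristic 2 *)

Lemma natF2_eq0 (m : nat) : (m%:R == 0 :> 'F_2) = ~~ odd m.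
Proof. by rewrite -(dvdn_pcharf (pchar_Fp (isT : prime 2))) dvdn2. Qed.

Lemma boolF2_neq0 (b : bool) : (b%:R != 0 :> 'F_2) = b.
Proof. by case: b. Qed.

Lemma lmodF2_addrr (W : lmodType 'F_2) (w : W) : w + w = 0.
Proof. by rewrite -[w]scale1r -scalerDl F2_addrr scale0r. Qed.

(** * Bijections compatible with given labels *)

(** Enumerate the fibres over each label and send the element at a given position in the fibre of
    [p] to the one at the same position in the fibre of [q]. *)
Lemma fiberwise_bijection (aT bT : finType) (I : eqType) (A : {set aT})
    (B : {set bT}) (p : aT -> I) (q : bT -> I) (y0 : bT) :
    (forall i, #|[set x in A | p x == i]| = #|[set y in B | q y == i]|) ->
  exists g : aT -> bT, [/\ {in A &, injective g}, g @: A = B &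
    {in A, forall x, q (g x) = p x}].
Proof.
move=> cardAB.
pose sA i := enum [set x in A | p x == i]; pose sB i := enum [set y in B | q y == i].
have szAB i : size (sA i) = size (sB i) by rewrite -!cardE.
pose g x := nth y0 (sB (p x)) (index x (sA (p x))).
have memA x : x \in A -> x \in sA (p x) by move=> xA; rewrite mem_enum inE xA eqxx.
have lt_x x : x \in A -> (index x (sA (p x)) < size (sB (p x)))%N.
  by move=> xA; rewrite -szAB index_mem memA.
have gE x : x \in A -> g x \in B /\ q (g x) = p x.
  by move=> xA; have := mem_nth y0 (lt_x x xA); rewrite mem_enum inE => /andP[? /eqP].
exists g; split; last by move=> x /gE[].
- move=> x x' xA x'A eq_g; have eq_p : p x = p x'.
    by have [_ <-] := gE x xA; have [_ <-] := gE x' x'A; rewrite eq_g.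
  have x'sA := memA x' x'A; have := lt_x x' x'A.
  move: eq_g x'sA; rewrite /g -eq_p => eq_g x'sA lt_x'.
  have /eqP := eq_g; rewrite nth_uniq ?enum_uniq ?lt_x // => /eqP eq_i.
  by rewrite -[x](nth_index x (memA x xA)) eq_i nth_index.
- apply/setP => y; apply/imsetP/idP => [[x /gE[gB _] ->] // | yB].
  have ysB : y \in sB (q y) by rewrite mem_enum inE yB eqxx.
  have lt_y : (index y (sB (q y)) < size (sA (q y)))%N by rewrite szAB index_mem.
  (* The default point for [nth] comes from the fibre itself, nonempty by [lt_y]. *)
  have [x0 _] : exists x0 : aT, True by case: (sA (q y)) lt_y => // x0; exists x0.
  pose x := nth x0 (sA (q y)) (index y (sB (q y))).
  have := mem_nth x0 lt_y; rewrite -/x mem_enum inE => /andP[xA /eqP px].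
  by exists x => //; rewrite /g px index_uniq ?enum_uniq // nth_index.
Qed.

(** Removing [a0] takes the same value out of both multisets, so every value keeps equal
    multiplicities on the complement of [a0]. A bijection of that complement then extends by fixing
    [a0]. *)
Lemma perm_eq_image_bijection (I : finType) (J : eqType) (F G : I -> J) (a0 : I) :
    perm_eq [seq F a | a : I] [seq G a | a : I] -> F a0 = G a0 ->
  exists f : I -> I, [/\ injective f, f a0 = a0 & forall a, G (f a) = F a].
Proof.
move=> permFG eq0.
have cardFG (i : J) : #|[set a in [set~ a0] | F a == i]| = #|[set a in [set~ a0] | G a == i]|.
  have split0 (H : I -> J) : count_mem i [seq H a | a : I] =
      ((H a0 == i) + #|[set a in [set~ a0] | H a == i]|)%N.
    have -> : count_mem i [seq H a | a : I] = #|[set a | H a == i]|.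
      rewrite cardE /enum_mem size_filter count_map /enum_mem filter_predT.
      by apply: eq_count => a; rewrite /= inE.
    rewrite (cardsD1 a0) inE; congr (_ + _)%N.
    by apply: eq_card => a; rewrite !inE.
  have /permP/(_ (pred1 i)) := permFG; rewrite !split0 eq0.
  exact: addnI.
have [g [g_inj gim gE]] := fiberwise_bijection a0 cardFG.
have gN a : a != a0 -> g a != a0.
  by move=> aN; have := imset_f g (_ : a \in [set~ a0]); rewrite gim !inE; apply.
exists (fun a => if a == a0 then a0 else g a); split=> [a b||a].
- case: ifP => [/eqP-> | /negbT aN]; case: ifP => [/eqP-> | /negbT bN] //.
  + by move=> eqg; case/eqP: (gN b bN).
  + by move=> eqg; case/eqP: (gN a aN).
  by apply: g_inj; rewrite !inE.
- by rewrite eqxx.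
- by case: ifP => [/eqP-> // | /negbT aN]; apply: gE; rewrite !inE.
Qed.

(** * Linear algebra: permutations of the plane and extension of affine maps *)

(* The four vectors 0, a, b, a + b exhaust the plane and sum to 0, so
   [f a + f b + f (a + b)] is the sum of all vectors. *)
Lemma injective_F2_plane_additive (f : 'rV['F_2]_2 -> 'rV['F_2]_2) :
  injective f -> f 0 = 0 -> {morph f : a b / a + b}.
Proof.
move=> f_inj f0 a b.
have [-> | aN] := eqVneq a 0; first by rewrite f0 !add0r.
have [-> | bN] := eqVneq b 0; first by rewrite f0 !addr0.
have [<- | abN] := eqVneq a b; first by rewrite !lmodF2_addrr f0.
have abN0 : a + b != 0.
  by apply: contraNneq abN => ab0; rewrite -[a]addr0 -(lmodF2_addrr b) addrA ab0 add0r.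
pose s := [:: 0; a; b; a + b].
have s_uniq : uniq s.
  have aNab : a != a + b by rewrite -{1}[a]addr0 (inj_eq (addrI a)) eq_sym.
  have bNab : b != a + b by rewrite -{1}[b]add0r (inj_eq (addIr b)) eq_sym.
  by rewrite /s /= !inE !negb_or !(eq_sym 0) aN bN abN abN0 aNab bNab.
have sT : s =i predT.
  by apply/subset_cardP; rewrite ?subset_predT // (card_uniqP s_uniq) card_mx card_Fp.
have sum_s (h : 'rV['F_2]_2 -> 'rV['F_2]_2) : \sum_v h v = h 0 + (h a + (h b + h (a + b))).
  rewrite -big_enum (perm_big s) /=; first by rewrite !big_cons big_nil (addr0 (h (a + b))).
  by apply: uniq_perm; rewrite ?enum_uniq // => v; rewrite mem_enum sT.
have sum0 : \sum_v f v = 0.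
  by rewrite -(reindex_inj f_inj (P := predT) (F := id)) (sum_s id) add0r addrA lmodF2_addrr.
have /eqP := sum_s f; rewrite sum0 f0 add0r addrA eq_sym addr_eq0 => /eqP eq_ab.
by rewrite eq_ab; apply/eqP; rewrite -addr_eq0 lmodF2_addrr.
Qed.

(* Equality of left kernels of the difference families means equality of column
   spaces, hence a unit of column operations carrying one to the other. *)
Lemma affine_extension (F : fieldType) (m n : nat) (A B : 'M[F]_(m, n)) :
    (forall u : 'rV_m, \sum_i u 0 i = 0 -> (u *m A == 0) = (u *m B == 0)) ->
  exists M b, M \in unitmx /\ forall i, row i B = row i A *m M + b.
Proof.
case: m A B => [|m] A B kerAB.
  by exists 1%:M, 0; split=> [|[]//]; rewrite unitmx1.
pose c (C : 'M[F]_(m.+1, n)) := \matrix_i (row i C - row 0 C).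
(* A combination of the differences is a combination of the rows of [C] with coefficient sum 0,
   which is the case [kerAB] covers. *)
have mul_c C (u : 'rV_m.+1) : u *m c C = (u - (\sum_i u 0 i) *: delta_mx 0 0) *m C.
  rewrite mulmxBl -scalemxAl -rowE [LHS]mulmx_sum_row [u *m C]mulmx_sum_row.
  rewrite scaler_suml -sumrB; apply: eq_bigr => i _.
  by rewrite rowK scalerBr.
have kercAB (u : 'rV[F]_m.+1) : (u *m c A == 0) = (u *m c B == 0).
  rewrite !mul_c; apply: kerAB; under eq_bigr => i _ do rewrite mxE [X in _ + X]mxE [X in _ - X]mxE.
  rewrite sumrB -{1}[\sum_i u 0 i]mulr1 -mulr_sumr -mulrBr.
  suff -> : \sum_i (delta_mx 0 0 : 'rV[F]_m.+1) 0 i = 1 by rewrite subrr mulr0.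
  rewrite (bigD1 0) //= big1 => [|i /negbTE iN]; last by rewrite mxE iN.
  by rewrite mxE !eqxx addr0.
(* Transposed, the columns of the cokernel of [(c D)^T] are row vectors killed by [c D]; the
   inclusion says that [c C] kills them too. *)
have subc C D : (forall u : 'rV[F]_m.+1, u *m c D = 0 -> u *m c C = 0) -> ((c C)^T <= (c D)^T)%MS.
  move=> kerCD; rewrite submxE -[X in X == _]trmxK trmx_eq0 trmx_mul trmxK.
  apply/eqP/row_matrixP => i; rewrite row_mul row0; apply: kerCD.
  by rewrite -row_mul -[X in _ *m X]trmxK -trmx_mul mulmx_coker trmx0 row0.
have : ((c B)^T == (c A)^T)%MS.
  by rewrite !subc // => u /eqP; [rewrite -kercAB | rewrite kercAB] => /eqP.
case/eqmxMunitP => P Pu cBA.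
have cB : c B = c A *m P^T by rewrite -[LHS]trmxK cBA trmx_mul trmxK.
exists P^T, (row 0 B - row 0 A *m P^T); split=> [|i]; first by rewrite unitmx_tr.
have := congr1 (row i) cB; rewrite row_mul !rowK mulmxBl => /eqP.
by rewrite subr_eq addrAC addrA => /eqP ->; rewrite addrAC.
Qed.

(** * Linear maps on the space of subsets *)

Section SetSum.
Variables (T : finType) (W : lmodType 'F_2) (f : T -> W).

(** With [f] constantly 1 this is the parity of [X]; with [f] the identity it is the vector sum. *)
Definition set_sum (X : pset T) : W := \sum_(x in (X : {set T})) f x.

Fact set_sum_linear : linear set_sum.
Proof.
move=> a X Y; rewrite /set_sum (sum_psetD f (a *: X) Y (@lmodF2_addrr W)); congr (_ + _).
by case: (F2_cases a) => ->; rewrite ?scale1r // !scale0r big_set0.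
Qed.

HB.instance Definition _ :=
  GRing.isLinear.Build 'F_2 (pset T) W *:%R set_sum set_sum_linear.

Lemma sum_F2_support (A : {set T}) (c : T -> 'F_2) :
  \sum_(x in A) c x *: f x = set_sum [set x in A | c x != 0].
Proof.
rewrite /set_sum [LHS]big_mkcond [RHS]big_mkcond; apply: eq_bigr => x _; rewrite inE.
by case: (x \in A) => //=; case: (F2_cases (c x)) => ->; rewrite ?scale0r ?scale1r.
Qed.

End SetSum.

Section SetDiff.
Variables (T : finType) (A : {set T}).

(** A linear map whose kernel is the power set of [A], which makes that power set a subspace. *)
Definition set_diff (X : pset T) : pset T := (X : {set T}) :\: A.

Fact set_diff_linear : linear set_diff.
Proof.
move=> a X Y; apply/setP => x; rewrite in_psetD [LHS]in_setD in_psetD.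
case: (F2_cases a) => ->; rewrite ?scale0r ?scale1r !(in_setD, in_set0).
  by [].
by case: (x \in A).
Qed.

HB.instance Definition _ :=
  GRing.isLinear.Build 'F_2 (pset T) (pset T) *:%R set_diff set_diff_linear.

Lemma mem_ker_set_diff (X : {set T}) :
  ((X : pset T) \in lker (linfun set_diff)) = (X \subset A).
Proof. by rewrite memv_ker lfunE /= -setD_eq0. Qed.

(** By counting: a subspace of dimension d over F_2 has 2 ^ d elements. *)
Lemma dim_ker_set_diff : \dim (lker (linfun set_diff)) = #|A|.
Proof.
apply: (@expnI 2) => //; rewrite -card_powerset.
have <- : #|lker (linfun set_diff)| = (2 ^ \dim (lker (linfun set_diff)))%N.
  by rewrite card_vspace card_Fp.
by apply: eq_card => X; rewrite powersetE mem_ker_set_diff.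
Qed.

End SetDiff.

(** * The dimension of E(S) *)

Section Dimension.
Variables (n : nat) (S : {set 'rV['F_2]_n}).
Local Notation V := 'rV['F_2]_n.

Lemma sub_affine_span : S \subset affine_span S.
Proof.
apply/subsetP => x xS; apply/imsetP; exists [ffun y => (y == x)%:R].
  rewrite inE (bigD1 x) //= big1 => [|y /andP[_ /negbTE yx]]; last by rewrite ffunE yx.
  by rewrite ffunE eqxx addr0.
rewrite (bigD1 x) //= big1 => [|y /andP[_ /negbTE yx]]; last by rewrite ffunE yx scale0r.
by rewrite ffunE eqxx scale1r addr0.
Qed.

Definition parity : 'Hom(pset V, ('F_2)^o) := linfun (set_sum (fun=> 1 : ('F_2)^o)).

Definition even_subsets : {vspace pset V} := (lker (linfun (set_diff S)) :&: lker parity)%VS.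

Lemma mem_even_subsets (X : {set V}) :
  ((X : pset V) \in even_subsets) = (X \subset S) && ~~ odd #|X|.
Proof.
rewrite memv_cap mem_ker_set_diff memv_ker lfunE /= /set_sum sumr_const.
by rewrite natF2_eq0.
Qed.

Lemma E_even_subsets : E S = (even_subsets :&: lker (linfun (set_sum (@id V))))%VS.
Proof.
apply/vspaceP => X; rewrite memv_cap mem_even_subsets Defs.memE memv_ker lfunE /=.
by rewrite andbA.
Qed.

(** Rank-nullity for [parity] on the power set of [S]; a singleton shows that the image has
    dimension 1. *)
Lemma dim_even_subsets : S != set0 -> (\dim even_subsets).+1 = #|S|.
Proof.
case/set0Pn => x0 x0S; rewrite -dim_ker_set_diff -(limg_ker_dim parity) -addn1.
congr (_ + _)%N; apply/esym/eqP; rewrite eqn_leq lt0n dimv_eq0.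
have -> : (\dim (parity @: lker (linfun (set_diff S))) <= 1)%N.
  by apply: leq_trans (dimvS (subvf _)) _; rewrite dimvf.
apply/eqP => img0; have : parity [set x0] \in (0 : {vspace ('F_2)^o})%VS.
  by rewrite -img0 memv_img // mem_ker_set_diff sub1set.
by rewrite memv0 lfunE /= /set_sum big_set1.
Qed.

(** The coefficients of two affine combinations differ by a family of sum 0, whose support is an
    even subset. Conversely, for even [X] the copies of [x0] cancel, so the sum of [X] is a sum of
    differences [x - x0]. *)
Lemma direction_even_subsets : S != set0 ->
  direction (affine_span S) = (linfun (set_sum (@id V)) @: even_subsets)%VS.
Proof.
case/set0Pn => x0 x0S; apply/eqP; rewrite eqEsubv; apply/andP; split.
  apply/span_subvP => _ /allpairsP[[x y] /= [+ + ->]]; rewrite !mem_enum.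
  case/imsetP => c; rewrite inE => /eqP c1 ->; case/imsetP => d; rewrite inE => /eqP d1 ->.
  rewrite -sumrB; under eq_bigr => z _ do rewrite -scalerBl.
  rewrite (sum_F2_support id S (fun z => c z - d z)).
  apply/memv_imgP; eexists; last by rewrite lfunE.
  rewrite memv_cap mem_ker_set_diff memv_ker lfunE /= -sum_F2_support.
  apply/andP; split; first by apply/subsetP => z; rewrite inE => /andP[].
  apply/eqP; under eq_bigr => z _ do rewrite /GRing.scale /= mulr1.
  by rewrite sumrB c1 d1 subrr.
apply/subvP => _ /memv_imgP[X XS ->]; rewrite lfunE /=.
move: XS; rewrite mem_even_subsets => /andP[/subsetP XS evenX].
have -> : set_sum id X = \sum_(x in (X : {set V})) (x - x0).
  rewrite sumrB sumr_const; suff -> : x0 *+ #|(X : {set V})| = 0 by rewrite subr0.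
  rewrite -scaler_nat; move: evenX; rewrite -natF2_eq0 => /eqP ->.
  by rewrite scale0r.
apply: memv_suml => x /XS xS; apply: memv_span; apply/allpairsP; exists (x, x0).
by rewrite !mem_enum !(subsetP sub_affine_span).
Qed.

(** Rank-nullity for the vector sum on even subsets: the kernel is [E S], the image is the direction
    of the affine span. *)
Lemma dim_E : S != set0 -> (\dim (E S) + affine_dim S).+1 = #|S|.
Proof.
move=> S0; rewrite -dim_even_subsets // /affine_dim direction_even_subsets //.
by rewrite E_even_subsets limg_ker_dim.
Qed.

End Dimension.

(** * Signatures, Venn regions and membership in E(S) *)

Section Signature.
Variables (n : nat).
Local Notation V := 'rV['F_2]_n.

Definition signature r (B : r.-tuple (pset V)) (x : V) : 'rV['F_2]_r :=
  \row_i (x \in (tnth B i : {set V}))%:R.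

(** Symmetric difference adds indicators mod 2, so membership of a fixed point is a linear
    functional on subsets. *)
Lemma in_combination r (B : r.-tuple (pset V)) (c : 'I_r -> 'F_2) (x : V) :
  (x \in (\sum_i c i *: tnth B i : {set V}))%:R =
  (signature B x *m \col_i c i) 0 0.
Proof.
rewrite mxE; under [RHS]eq_bigr => i _ do rewrite !mxE mulrC.
pose memr (X : pset V) : 'F_2 := (x \in (X : {set V}))%:R.
rewrite -[LHS]/(memr _); apply: (big_rec2 (fun X a => memr X = a)) => [|i a X _ <-].
  by rewrite /memr in_set0.
rewrite /memr in_psetD; case: (F2_cases (c i)) => ->.
  by rewrite scale0r in_set0 mul0r add0r.
rewrite scale1r mul1r.
by case: (x \in _); case: (x \in _); rewrite /= ?addr0 ?add0r ?F2_addrr.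
Qed.

Lemma mem_venn_region S r (B : r.-tuple (pset V)) a x :
  (x \in venn_region S B a) = (x \in S) && (signature B x == a).
Proof.
rewrite !inE -andbA; case xS: (x \in S) => //=; apply/andP/eqP => [[/bigcapP x1 /bigcapP x0] | <-].
  apply/rowP => i; rewrite mxE; have [ai | ai] := eqVneq (a 0 i) 0.
    by have := x0 i; rewrite ai eqxx inE => /(_ isT)/andP[/negbTE ->].
  by rewrite x1 //; move: ai; case: (F2_cases (a 0 i)) => ->.
split; apply/bigcapP => i; rewrite mxE ?inE ?xS ?andbT.
  by rewrite boolF2_neq0.
by case: (x \in _).
Qed.

Lemma signature_out S r (B : r.-tuple (pset V)) x :
  basis_of (E S) B -> x \notin S -> signature B x = 0.
Proof.
move=> /andP[/eqP spanB _] xNS; apply/rowP => i; rewrite !mxE.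
have : tnth B i \in E S by rewrite -spanB memv_span ?mem_tnth.
by rewrite Defs.memE => /and3P[/subsetP BS _ _]; rewrite (contraNF (BS x)).
Qed.

Lemma mem_E_signature S r (B : r.-tuple (pset V)) (Z : {set V}) :
    basis_of (E S) B -> Z \subset S ->
  (Z : pset V) \in E S <->
  exists c : 'cV_r, {in S, forall x, (x \in Z)%:R = (signature B x *m c) 0 0}.
Proof.
move=> basisB ZS; have [/eqP spanB _] := andP basisB; split=> [ZE | [c Zc]].
  exists (\col_i coord B i (Z : pset V)) => x _; rewrite -in_combination.
  suff {1}-> : Z = \sum_i coord B i (Z : pset V) *: tnth B i :> pset V by [].
  under eq_bigr => i _ do rewrite (tnth_nth 0).
  by apply: coord_span; rewrite spanB.
have -> : Z = \sum_i c i 0 *: tnth B i :> pset V.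
  apply/setP => x; rewrite -[LHS]boolF2_neq0 -[RHS]boolF2_neq0 in_combination.
  have -> : \col_i c i 0 = c by apply/colP => i; rewrite mxE.
  have [xS | xNS] := boolP (x \in S); first by rewrite Zc.
  by rewrite (signature_out basisB xNS) mul0mx mxE (contraNF (subsetP ZS x)).
rewrite -spanB; apply: memv_suml => i _; apply: memvZ.
by rewrite memv_span ?mem_tnth.
Qed.

(** The combination of the basis with coefficients [c] contains no point, so [c] is 0 by freeness.
    Thus the signatures of the points of [S] span the whole space. *)
Lemma signature_separates S r (B : r.-tuple (pset V)) (c : 'cV_r) :
  basis_of (E S) B -> {in S, forall x, signature B x *m c = 0} -> c = 0.
Proof.
move=> basisB c0; have [_ /freeP freeB] := andP basisB; apply/colP => i; rewrite mxE.
apply: (freeB (fun i => c i 0)); under eq_bigr => j _ do rewrite -tnth_nth.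
apply/setP => x; rewrite in_set0 -[LHS]boolF2_neq0 in_combination.
have -> : \col_j c j 0 = c by apply/colP => j; rewrite mxE.
have [xS | xNS] := boolP (x \in S); first by rewrite c0 // mxE eqxx.
by rewrite (signature_out basisB xNS) mul0mx mxE eqxx.
Qed.

(** If a functional [c] of the [X]-signature cuts out [Z], then [N *m c] cuts out the image of [Z]
    by [Y]-signatures. *)
Lemma E_imset_signature S T r s (X : r.-tuple (pset V)) (Y : s.-tuple (pset V))
    (g : V -> V) (N : 'M['F_2]_(s, r)) (Z : {set V}) :
    basis_of (E S) X -> basis_of (E T) Y ->
    {in S &, injective g} -> g @: S = T ->
    {in S, forall x, signature X x = signature Y (g x) *m N} ->
  Z \subset S -> (Z : pset V) \in E S -> (g @: Z : pset V) \in E T.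
Proof.
move=> basisX basisY g_inj gST sigE ZS /(mem_E_signature basisX ZS)[c Zc].
apply/(mem_E_signature basisY); first by rewrite -gST imsetS.
exists (N *m c) => y; rewrite -gST => /imsetP[x xS ->].
rewrite mulmxA -sigE // -Zc //; congr (nat_of_bool _)%:R.
apply/imsetP/idP => [[z zZ /g_inj ->] // | xZ]; last by exists x.
exact: (subsetP ZS).
Qed.

End Signature.

(** * Affine dependencies and affine maps *)

(** Over F_2 the row [u] is the indicator of its support: coefficient sum 0 means even size, and the
    matrix product is the sum of the selected points. *)
Lemma E_family_kernel (n m : nat) (S : {set 'rV['F_2]_n}) (h : 'I_m -> 'rV['F_2]_n)
    (u : 'rV['F_2]_m) :
    injective h -> (forall i, h i \in S) -> \sum_i u 0 i = 0 ->
  (u *m \matrix_i h i == 0) = ((h @: [set i | u 0 i != 0] : pset _) \in E S).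
Proof.
move=> h_inj hS u0; set Z := [set i | _].
have sumE (W : lmodType 'F_2) (f : 'I_m -> W) : \sum_i u 0 i *: f i = \sum_(i in Z) f i.
  have := sum_F2_support f setT (u 0); rewrite /set_sum (eq_bigl predT) => [->|i]; last by rewrite inE.
  by apply: eq_bigl => i; rewrite !inE.
rewrite Defs.memE; have -> : h @: Z \subset S.
  by apply/subsetP => _ /imsetP[i _ ->].
have -> : ~~ odd #|h @: Z|.
  rewrite card_imset // -natF2_eq0 -sumr_const; apply/eqP.
  rewrite -[RHS]u0 -(sumE ('F_2)^o (fun=> 1)).
  by apply: eq_bigr => i _; rewrite /GRing.scale /= mulr1.
rewrite big_imset /=; last by move=> i j _ _ /h_inj.
by rewrite mulmx_sum_row -sumE; under eq_bigr => i _ do rewrite rowK.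
Qed.

(** Members of [E] are the affine dependencies, so an enumeration of [S] and its image under [g]
    satisfy the same ones and [affine_extension] applies. *)
Lemma affinely_equivalent_of_E (n : nat) (S T : {set 'rV['F_2]_n})
    (g : 'rV['F_2]_n -> 'rV['F_2]_n) :
    {in S &, injective g} -> g @: S = T ->
    (forall Z : {set 'rV['F_2]_n}, Z \subset S ->
       ((Z : pset _) \in E S) = ((g @: Z : pset _) \in E T)) ->
  affinely_equivalent S T.
Proof.
move=> g_inj gST gE; pose h (i : 'I_#|S|) := enum_val i.
have hS i : h i \in S by apply: enum_valP.
have gh_inj : injective (g \o h) by move=> i j /g_inj/enum_val_inj; apply; apply: enum_valP.
have [|M [b [Mu MbE]]] := @affine_extension _ _ _ (\matrix_i h i) (\matrix_i g (h i)).
  move=> u u0; rewrite (E_family_kernel enum_val_inj hS u0).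
  rewrite (@E_family_kernel _ _ T (g \o h)) // => [|i]; last by rewrite -gST; apply: imset_f.
  by rewrite imset_comp gE //; apply/subsetP => _ /imsetP[i _ ->].
exists (fun x => x *m M + b); split; first by exists M, b.
rewrite -gST; apply: eq_in_imset => x xS.
by have := MbE (enum_rank_in xS x); rewrite !rowK /h enum_rankK_in.
Qed.

(** In the sum over an even set the translation [b] cancels, and the invertible [M] can then be
    removed. *)
Lemma affine_preimage_E (n : nat) (S T Z : {set 'rV['F_2]_n}) (M : 'M['F_2]_n)
    (b : 'rV['F_2]_n) (f := fun x => x *m M + b) :
    M \in unitmx -> f @: S = T -> (Z : pset _) \in E T ->
  (S :&: f @^-1: Z : pset _) \in E S.
Proof.
move=> Mu fST; rewrite !Defs.memE => /and3P[ZT evenZ /eqP sumZ].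
have f_inj : injective f by move=> x y /addIr /(can_inj (mulmxK Mu)).
have fZ : f @: (S :&: f @^-1: Z) = Z.
  apply/setP => y; apply/imsetP/idP => [[x /setIP[_]] | yZ]; first by rewrite inE => + ->.
  have := subsetP ZT y yZ; rewrite -fST => /imsetP[x xS yE].
  by exists x; rewrite // !inE xS -yE.
rewrite subsetIl /= -(card_imset _ f_inj) fZ evenZ /=.
move: sumZ; rewrite -fZ big_imset /=; last by move=> x y _ _ /f_inj.
rewrite big_split /= -mulmx_suml sumr_const.
rewrite -(card_imset _ f_inj) fZ -scaler_nat.
move: evenZ; rewrite -natF2_eq0 => /eqP ->; rewrite scale0r addr0 => sumM.
by rewrite -(mulmxK Mu (\sum_(x in _) x)) sumM mul0mx.
Qed.

(** * The two directions of the equivalence *)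

Lemma venn_cards_affine (n r : nat) (S T : {set 'rV['F_2]_n})
    (X Y : r.-tuple (pset 'rV['F_2]_n)) :
    basis_of (E S) X -> basis_of (E T) Y -> affinely_equivalent S T ->
  perm_eq (venn_cards S X) (venn_cards T Y) /\
  #|isolated_points S| = #|isolated_points T|.
Proof.
move=> basisX basisY [f [[M [b [Mu fE]]] fST]].
have f_inj : injective f by move=> x y; rewrite !fE => /addIr /(can_inj (mulmxK Mu)).
have fST' : (fun x => x *m M + b) @: S = T by rewrite -fST; apply: eq_imset => x; rewrite fE.
(* The preimage of each basis member of [E T] lies in [E S], hence is given by a functional [c] of
   the [X]-signature; these functionals are the columns of [C]. *)
have exc (j : 'I_r) : exists c : 'cV_r, {in S, forall x,
    (f x \in (tnth Y j : {set _}))%:R = (signature X x *m c) 0 0}.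
  have YE : tnth Y j \in E T by case/andP: basisY => /eqP <- _; rewrite memv_span ?mem_tnth.
  have [c cE] := (mem_E_signature basisX (subsetIl _ _)).1 (affine_preimage_E Mu fST' YE).
  by exists c => x xS; rewrite -cE // !inE xS fE.
have [c cE] := fin_all_exists exc; pose C := \matrix_(i, j) c j i 0.
have sigE x : x \in S -> signature Y (f x) = signature X x *m C.
  move=> xS; apply/rowP => j; rewrite mxE cE // !mxE.
  by apply: eq_bigr => i _; rewrite [C i j]mxE.
(* A column killed by [C] vanishes on every signature of a point of [T], hence is 0. *)
have Cu : C \in unitmx.
  rewrite -unitmx_tr -row_free_unit; apply: inj_row_free => v vC.
  apply: trmx_inj; rewrite trmx0; apply: (signature_separates basisY) => y.
  rewrite -fST => /imsetP[x xS ->]; rewrite sigE // -mulmxA.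
  by rewrite -[C]trmxK -trmx_mul vC trmx0 mulmx0.
have cardE a : #|venn_region S X a| = #|venn_region T Y (a *m C)|.
  rewrite -(card_imset _ f_inj); apply: eq_card => y; rewrite mem_venn_region.
  apply/imsetP/andP => [[x] | [+ /eqP sy]].
    rewrite mem_venn_region => /andP[xS /eqP <-] ->.
    by rewrite -fST imset_f // sigE.
  rewrite -fST => /imsetP[x xS yE]; exists x => //.
  rewrite mem_venn_region xS; apply/eqP/(can_inj (mulmxK Cu)).
  by rewrite -sigE // -yE.
split; last by rewrite !(isolated_pointsE basisX, isolated_pointsE basisY) cardE mul0mx.
(* Multiplication by [C] permutes the index vectors. *)
rewrite /venn_cards /image_mem (eq_map cardE) (map_comp (fun a => #|venn_region T Y a|)).
apply: perm_map; apply: uniq_perm; rewrite ?enum_uniq //.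
  by rewrite map_inj_uniq ?enum_uniq //; apply: can_inj (mulmxK Cu).
move=> a; rewrite mem_enum; apply/mapP; exists (a *m invmx C); rewrite ?mem_enum //.
by rewrite mulmxKV.
Qed.

Lemma affinely_equivalent_of_venn_cards (n : nat) (S T : {set 'rV['F_2]_n})
    (X Y : 2.-tuple (pset 'rV['F_2]_n)) :
    basis_of (E S) X -> basis_of (E T) Y ->
    perm_eq (venn_cards S X) (venn_cards T Y) ->
    #|isolated_points S| = #|isolated_points T| ->
  affinely_equivalent S T.
Proof.
move=> basisX basisY permXY.
rewrite (isolated_pointsE basisX) (isolated_pointsE basisY) => card0.
have [s [s_inj s0 sE]] := perm_eq_image_bijection permXY card0.
have sD := injective_F2_plane_additive s_inj s0.
pose M := \matrix_i s (delta_mx 0 i).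
have sM a : s a = a *m M.
  rewrite mulmx_sum_row {1}[a]row_sum_delta (big_morph s sD s0).
  apply: eq_bigr => i _; rewrite rowK.
  by case: (F2_cases (a 0 i)) => ->; rewrite ?scale0r ?scale1r.
have Mu : M \in unitmx.
  rewrite -row_free_unit; apply: inj_row_free => v; rewrite -sM -{1}s0.
  exact: s_inj.
(* The labels on [S] are relabelled by [s], so that regions of equal size receive the same label. *)
have cardST a : #|[set x in S | signature X x *m M == a]| =
    #|[set y in T | signature Y y == a]|.
  transitivity #|venn_region S X (a *m invmx M)|.
    apply: eq_card => x; rewrite mem_venn_region inE.
    by rewrite -[signature X x == _](inj_eq (can_inj (mulmxK Mu))) /= mulmxKV.
  by rewrite -sE sM mulmxKV //; apply: eq_card => y; rewrite mem_venn_region inE.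
have [g [g_inj gST gE]] := fiberwise_bijection 0 cardST.
(* An inverse of [g] on [T], with default value 0 elsewhere, lets [E_imset_signature] be applied in
   the opposite direction. *)
have [g' g'K] : exists g' : 'rV['F_2]_n -> 'rV['F_2]_n, {in S, cancel g g'}.
  exists (fun y => odflt 0 [pick x in S | g x == y]) => x xS.
  by case: pickP => [z /andP[zS /eqP/g_inj ->] // | /(_ x)]; rewrite xS eqxx.
have g'im (Z : {set 'rV['F_2]_n}) : Z \subset S -> g' @: (g @: Z) = Z.
  move=> /subsetP ZS; rewrite -imset_comp -[RHS]imset_id.
  by apply: eq_in_imset => x /ZS; apply: g'K.
apply: (affinely_equivalent_of_E g_inj gST) => Z ZS; apply/idP/idP.
  apply: (E_imset_signature basisX basisY g_inj gST (N := invmx M)) => // x xS.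
  by rewrite gE // mulmxK.
rewrite -{2}(g'im Z ZS).
apply: (E_imset_signature basisY basisX (N := M)); last by rewrite -gST imsetS.
- by move=> u v; rewrite -gST => /imsetP[x xS ->] /imsetP[y yS ->]; rewrite !g'K // => ->.
- by rewrite -gST g'im.
- by move=> u; rewrite -gST => /imsetP[x xS ->]; rewrite g'K // gE.
Qed.

Theorem theorem6p1 (n k : nat) (S T : {set 'rV['F_2]_n})
    (cardS : #|S| = k) (cardT : #|T| = k)
    (dimS : (affine_dim S + 3)%N = k) (dimT : (affine_dim T + 3)%N = k)
    (r s : nat) (X : r.-tuple (pset 'rV['F_2]_n)) (Y : s.-tuple (pset 'rV['F_2]_n))
    (basisX : basis_of (E S) X) (basisY : basis_of (E T) Y) :
  affinely_equivalent S T <->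
  perm_eq (venn_cards S X) (venn_cards T Y) /\
  #|isolated_points S| = #|isolated_points T|.
Proof.
have dim2 (A : {set 'rV['F_2]_n}) : #|A| = k -> (affine_dim A + 3)%N = k -> \dim (E A) = 2.
  (* The dimension formula [dim_E] requires a nonempty set; here the cardinality is at least 3. *)
  move=> cardA dimA; have A0 : A != set0.
    by apply/eqP => A0; move: dimA; rewrite -cardA A0 cards0 addn3.
  apply: (@addIn (affine_dim A).+1); rewrite addnS dim_E // cardA -dimA.
  by rewrite addn3.
have r2 : r = 2 by rewrite -(size_basis basisX) dim2.
have s2 : s = 2 by rewrite -(size_basis basisY) dim2.
subst r s; split; first exact: venn_cards_affine.
by case; apply: affinely_equivalent_of_venn_cards.
Qed.
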